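(* Let $D_+,D_-$ be periodic diagonal-norm first-derivative upwind SBP operators and $D$ a periodic first-derivative SBP operator, all with the same diagonal mass matrix $M$. Consider an ImEx Runge-Kutta (ImEx-RK) method of type I applied with fixed time step $\Delta t>0$ to the splitting $$\partial_t\mathbf q=f(\mathbf q)+g(\mathbf q),\qquad \mathbf q=\begin{pmatrix}\mathbf u\\\mathbf v\\\mathbf w\end{pmatrix},\quad f(\mathbf q)=\begin{pmatrix}-\tfrac13(D\mathbf u^2+\mathbf u\,D\mathbf u)\\\mathbf 0\\\mathbf 0\end{pmatrix},\quad g(\mathbf q)=\begin{pmatrix}-D_+\mathbf w\\ \tfrac1\tau(D\mathbf v-\mathbf w)\\ \tfrac1\tau(-D_-\mathbf u+\mathbf v)\end{pmatrix}$$ of the semidiscrete hyperbolic approximation (with relaxation parameter $\tau>0$) of the KdV equation. Then the method is asymptotic preserving (AP) for the $\mathbf u$-component. Furthermore, if the method is globally stiffly accurate, then it is also AP for the auxiliary components $\mathbf v$ and $\mathbf w$.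
   Context: SBP operators: all vectors are in $\mathbb R^N$, and nonlinear operations are pointwise: $\mathbf u^2=(u_i^2)_i$, $\mathbf u\,D\mathbf u=(u_i(D\mathbf u)_i)_i$. A periodic first-derivative SBP operator consists of a grid, a consistent first-derivative matrix $D\in\mathbb R^{N\times N}$, and a symmetric positive-definite matrix $M$ with $MD+D^TM=0$. A periodic first-derivative upwind SBP operator consists of a grid, consistent first-derivative matrices $D_\pm$, and a symmetric positive-definite $M$ with $MD_++D_-^TM=0$ and $\tfrac12M(D_+-D_-)$ negative semidefinite. Diagonal-norm means $M$ is diagonal. Consistency includes $D\mathbf 1=D_\pm\mathbf 1=\mathbf 0$, where $\mathbf 1=(1,\dots,1)^T$. ImEx-RK method: given a strictly lower triangular explicit matrix $\tilde A=(\tilde a_{ij})\in\mathbb R^{s\times s}$, a lower triangular implicit matrix $A=(a_{ij})\in\mathbb R^{s\times s}$ and weights $\tilde{\mathbf b},\mathbf b\in\mathbb R^s$, the method computes from $\mathbf q^n$ $$\mathbf q^{(i)}=\mathbf q^n+\Delta t\Big(\sum_{j=1}^{i-1}\tilde a_{ij}f(\mathbf q^{(j)})+\sum_{j=1}^{i}a_{ij}g(\mathbf q^{(j)})\Big),\ i=1,\dots,s,\qquad \mathbf q^{n+1}=\mathbf q^n+\Delta t\Big(\sum_{j=1}^s\tilde b_jf(\mathbf q^{(j)})+\sum_{j=1}^s b_jg(\mathbf q^{(j)})\Big).$$ It is of type I if $A$ is invertible. It is globally stiffly accurate if $\tilde a_{si}=\tilde b_i$ and $a_{si}=b_i$ for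 $i=1,\dots,s$. AP property: let $\boldsymbol\eta^{n}$ be the numerical solution obtained with the same ImEx-RK method and the same $\Delta t$ for the semidiscrete KdV equation $\partial_t\boldsymbol\eta=f(\boldsymbol\eta)+g(\boldsymbol\eta)$ with $f(\boldsymbol\eta)=-\tfrac13(D\boldsymbol\eta^2+\boldsymbol\eta\,D\boldsymbol\eta)$ (explicit) and $g(\boldsymbol\eta)=-D_+DD_-\boldsymbol\eta$ (implicit). AP for the $\mathbf u$-component means $\mathbf u^{n+1}\to\boldsymbol\eta^{n+1}$ as $\tau\to0$ for every $n\ge0$ (with $\Delta t$ and the spatial operators fixed). AP for the auxiliary components means $\mathbf v^{n+1}\to D_-\boldsymbol\eta^{n+1}$ and $\mathbf w^{n+1}\to DD_-\boldsymbol\eta^{n+1}$ as $\tau\to0$. The initial data $\mathbf u^0,\mathbf v^0,\mathbf w^0$ (possibly depending on $\tau$) have finite limits as $\tau\to0$, and $\boldsymbol\eta^0=\lim_{\tau\to0}\mathbf u^0$. *)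

(* Defs.v *)
From HB Require Import structures.
From mathcomp Require Import all_boot all_order all_algebra.
From mathcomp Require Import all_classical all_reals all_analysis.

Set Implicit Arguments.
Unset Strict Implicit.
Unset Printing Implicit Defensive.

Import Order.TTheory GRing.Theory Num.Theory.
Import numFieldNormedType.Exports.

Local Open Scope classical_set_scope.
Local Open Scope ring_scope.

Definition qform (R : realType) (N : nat) (S : 'M[R]_N) (x : 'cV[R]_N) : R :=
  (x^T *m S *m x) 0 0.

Definition sym_posdef (R : realType) (N : nat) (S : 'M[R]_N) : Prop :=
  S^T = S /\ forall x : 'cV[R]_N, x != 0 -> 0 < qform S x.

Definition neg_semidef (R : realType) (N : nat) (S : 'M[R]_N) : Prop :=
  forall x : 'cV[R]_N, qform S x <= 0.

(* Consistency of a derivative matrix on a single, fixed periodic grid means  *)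
(* that constants are differentiated exactly; no order of accuracy relative   *)
(* to the nodes is imposed.                                                   *)
Definition consistent (R : realType) (N : nat) (D : 'M[R]_N) : Prop :=
  D *m const_mx 1 = 0 :> 'cV[R]_N.

Record periodic_SBP (R : realType) (N : nat) := PeriodicSBP {
  sbp_grid : 'cV[R]_N;
  sbp_D : 'M[R]_N;
  sbp_M : 'M[R]_N;
  sbp_consistent : consistent sbp_D;
  sbp_mass : sym_posdef sbp_M;
  sbp_parts : sbp_M *m sbp_D + sbp_D^T *m sbp_M = 0
}.

Record periodic_upwind_SBP (R : realType) (N : nat) := PeriodicUpwindSBP {
  upw_grid : 'cV[R]_N;
  upw_Dp : 'M[R]_N;
  upw_Dm : 'M[R]_N;
  upw_M : 'M[R]_N;
  upw_consistent_p : consistent upw_Dp;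
  upw_consistent_m : consistent upw_Dm;
  upw_mass : sym_posdef upw_M;
  upw_parts : upw_M *m upw_Dp + upw_Dm^T *m upw_M = 0;
  upw_dissipative : neg_semidef (2^-1 *: (upw_M *m (upw_Dp - upw_Dm)))
}.

(* A method with s.+1 stages, numbered 0, ..., s: there is always at least    *)
(* one stage, and ord_max is the last one. is_trig_mx means lower triangular. *)
Record ImExRK (R : realType) (s : nat) := ImExRKMethod {
  rk_At : 'M[R]_s.+1;
  rk_A : 'M[R]_s.+1;
  rk_bt : 'I_s.+1 -> R;
  rk_b : 'I_s.+1 -> R;
  rk_explicit : forall i j : 'I_s.+1, (i <= j)%N -> rk_At i j = 0;
  rk_implicit : is_trig_mx rk_A
}.

Definition type_I (R : realType) (s : nat) (rk : ImExRK R s) : Prop :=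
  rk_A rk \in unitmx.

Definition globally_stiffly_accurate (R : realType) (s : nat)
    (rk : ImExRK R s) : Prop :=
  forall i : 'I_s.+1,
    rk_At rk ord_max i = rk_bt rk i /\ rk_A rk ord_max i = rk_b rk i.

(* The stages are implicitly defined, hence a relation between q^n, q^(n+1).  *)
Definition imex_step (R : realType) (s : nat) (rk : ImExRK R s) (dt : R)
    (V : lmodType R) (f g : V -> V) (q q' : V) : Prop :=
  exists Q : 'I_s.+1 -> V,
    (forall i : 'I_s.+1,
       Q i = q + dt *: (\sum_(j < s.+1 | (j < i)%N) rk_At rk i j *: f (Q j)
                      + \sum_(j < s.+1 | (j <= i)%N) rk_A rk i j *: g (Q j)))
    /\ q' = q + dt *: (\sum_(j < s.+1) rk_bt rk j *: f (Q j)
                     + \sum_(j < s.+1) rk_b rk j *: g (Q j)).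

Definition imex_solution (R : realType) (s : nat) (rk : ImExRK R s) (dt : R)
    (V : lmodType R) (f g : V -> V) (q : nat -> V) : Prop :=
  forall n : nat, imex_step rk dt f g (q n) (q n.+1).

Definition kdv_f (R : realType) (N : nat) (D : 'M[R]_N) (u : 'cV[R]_N) :
    'cV[R]_N :=
  - (3^-1 *: (D *m map_mx (fun x => x ^+ 2) u + map2_mx *%R u (D *m u))).

Definition kdv_g (R : realType) (N : nat) (Dp Dm D : 'M[R]_N)
    (u : 'cV[R]_N) : 'cV[R]_N :=
  - (Dp *m D *m Dm *m u).

(* q = (u, v, w) *)
Definition state (R : realType) (N : nat) : lmodType R :=
  ('cV[R]_N * 'cV[R]_N * 'cV[R]_N)%type.

Definition ucomp (R : realType) (N : nat) (q : state R N) : 'cV[R]_N := q.1.1.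
Definition vcomp (R : realType) (N : nat) (q : state R N) : 'cV[R]_N := q.1.2.
Definition wcomp (R : realType) (N : nat) (q : state R N) : 'cV[R]_N := q.2.

Definition hyp_f (R : realType) (N : nat) (D : 'M[R]_N) (q : state R N) :
    state R N :=
  (kdv_f D (ucomp q), 0, 0).

Definition hyp_g (R : realType) (N : nat) (Dp Dm D : 'M[R]_N) (tau : R)
    (q : state R N) : state R N :=
  (- (Dp *m wcomp q),
   tau^-1 *: (D *m vcomp q - wcomp q),
   tau^-1 *: (- (Dm *m ucomp q) + vcomp q)).

(* q tau is the numerical solution for the relaxation parameter tau, started  *)
(* from possibly tau-dependent data; eta is the numerical solution of the     *)
(* limit equation by the same method with the same time step.                 *)
Record relaxation_limit_data (R : realType) (N s : nat) (Dp Dm D : 'M[R]_N)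
    (rk : ImExRK R s) (dt : R) (q : R -> nat -> state R N)
    (eta : nat -> 'cV[R]_N) : Prop := RelaxationLimitData {
  rl_hyp : forall tau : R, 0 < tau ->
    imex_solution rk dt (@hyp_f R N D) (@hyp_g R N Dp Dm D tau) (q tau);
  rl_kdv : imex_solution rk dt (@kdv_f R N D) (@kdv_g R N Dp Dm D) eta;
  rl_u0 : ucomp (q tau 0%N) @[tau --> 0^'+] --> eta 0%N;
  rl_v0 : exists v0 : 'cV[R]_N, vcomp (q tau 0%N) @[tau --> 0^'+] --> v0;
  rl_w0 : exists w0 : 'cV[R]_N, wcomp (q tau 0%N) @[tau --> 0^'+] --> w0
}.

Definition AP_u (R : realType) (N s : nat) (Dp Dm D : 'M[R]_N)
    (rk : ImExRK R s) (dt : R) : Prop :=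
  forall (q : R -> nat -> state R N) (eta : nat -> 'cV[R]_N),
    relaxation_limit_data Dp Dm D rk dt q eta ->
    forall n : nat, ucomp (q tau n.+1) @[tau --> 0^'+] --> eta n.+1.

Definition AP_aux (R : realType) (N s : nat) (Dp Dm D : 'M[R]_N)
    (rk : ImExRK R s) (dt : R) : Prop :=
  forall (q : R -> nat -> state R N) (eta : nat -> 'cV[R]_N),
    relaxation_limit_data Dp Dm D rk dt q eta ->
    forall n : nat,
      vcomp (q tau n.+1) @[tau --> 0^'+] --> Dm *m eta n.+1 /\
      wcomp (q tau n.+1) @[tau --> 0^'+] --> D *m Dm *m eta n.+1.

(* Main.v *)
(* The v- and w-equations of stage i, with alpha = dt a_ii, read              *)
(*   w = D v - (tau / alpha) (v - V),  v = D_- u + (tau / alpha) (w - W),     *)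
(* where V, W collect q^n and the earlier stages.  Eliminating u and v leaves *)
(* a linear system for w whose matrix tends to 1 + alpha D D_- D_+.  If w is  *)
(* in the kernel of this limit, x = D_+ w satisfies x = - alpha D_+ D D_- x,  *)
(* so x^T M x = 0 because M D_+ D D_- = - D_-^T (M D) D_- is skew; hence      *)
(* x = 0 and w = 0, whatever the sign of alpha.  So every stage converges to  *)
(* the KdV stage, with w -> D v and v -> D_- u.  Convergence of the 1/tau     *)
(* increments of v and w, solved for from the stage equations (a_ii <> 0),    *)
(* keeps v^{n+1} and w^{n+1} convergent, so that one can step to n + 1.       *)

Require Import Defs.
From HB Require Import structures.
From mathcomp Require Import all_boot all_order all_algebra.
From mathcomp Require Import all_classical all_reals all_analysis.
From mathcomp Require Import lra.

Import Order.TTheory GRing.Theory Num.Theory.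
Import numFieldNormedType.Exports.

Local Open Scope classical_set_scope.
Local Open Scope ring_scope.

(** Multiplied by [tau], the relaxation equations of a stage become a regular perturbation of the
    constraints [v = D_- u], [w = D v], with small parameter [tau / alpha], where [alpha = dt a_ii]
    is nonzero by type I. The resulting linear system for [w] has an invertible limit matrix
    ([SBP_unitmx]), so Cramer's rule gives convergence of its solution ([cvg_linear_system]), and
    the limit of the stage is the KdV stage ([cvg_implicit_stage]).

    The update contains the stiff increments themselves. They converge because each stage equation
    can be solved for its own increment ([cvg_increment]). Hence one step preserves the invariant
    that [u] tends to [eta] while [v] and [w] have some limit ([cvg_hyp_step]), and induction on [n]
    gives AP for [u]. Under global stiff accuracy the update is the last stage ([gsa_update]), whose
    [v] and [w] already have the required limits. *)

(** * Limits of matrix expressions and of solutions of linear systems *)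

Lemma cvg_mx {R : realType} {T : Type} {F : set_system T} {FF : Filter F}
    {m n : nat} (f : T -> 'M[R]_(m, n)) (A : 'M[R]_(m, n)) :
  (forall i j, f t i j @[t --> F] --> A i j) -> f t @[t --> F] --> A.
Proof.
move=> fA; apply/cvgrPdist_le => /= e e0; near=> t.
rewrite /Num.Def.normr/= mx_normrE (bigmax_le _ (ltW e0))//= => i _.
rewrite !mxE; move: i; near: t; apply: filter_forall => /= i.
exact: ((cvgrPdist_le _ _).1 (fA i.1 i.2)).
Unshelve. all: by end_near. Qed.

Lemma cvg_mx_coord {R : realType} {T : Type} {F : set_system T}
    {FF : Filter F} {m n : nat} {f : T -> 'M[R]_(m, n)} {A : 'M[R]_(m, n)}
    (i : 'I_m) (j : 'I_n) :
  f t @[t --> F] --> A -> f t i j @[t --> F] --> A i j.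
Proof.
by move=> fA; exact: (cvg_comp _ _ fA (@coord_continuous _ _ _ i j A)).
Qed.

Lemma cvg_sumr {R : realType} {V : normedModType R} {T I : Type}
    {F : set_system T} {FF : Filter F} (r : seq I) (P : pred I)
    (f : I -> T -> V) (a : I -> V) :
  (forall i, P i -> f i t @[t --> F] --> a i) ->
  \sum_(i <- r | P i) f i t @[t --> F] --> \sum_(i <- r | P i) a i.
Proof. by move=> fa; apply: cvg_big => //; exact: add_continuous. Qed.

Lemma cvg_lincomb {R : realType} {V : normedModType R} {T I : Type}
    {F : set_system T} {FF : Filter F} (r : seq I) (P : pred I)
    (c : I -> R) (f : I -> T -> V) (a : I -> V) :
  (forall i, P i -> f i t @[t --> F] --> a i) ->
  \sum_(i <- r | P i) c i *: f i t @[t --> F] -->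
  \sum_(i <- r | P i) c i *: a i.
Proof. by move=> fa; apply: cvg_sumr => i Pi; apply: cvgZl_tmp; exact: fa. Qed.

Lemma cvg_prodr {R : realType} {T I : Type}
    {F : set_system T} {FF : Filter F} (r : seq I) (P : pred I)
    (f : I -> T -> R) (a : I -> R) :
  (forall i, P i -> f i t @[t --> F] --> a i) ->
  \prod_(i <- r | P i) f i t @[t --> F] --> \prod_(i <- r | P i) a i.
Proof. by move=> fa; apply: cvg_big => //; exact: mul_continuous. Qed.

Lemma cvg_mulmx {R : realType} {T : Type} {F : set_system T} {FF : Filter F}
    {m n p : nat} {f : T -> 'M[R]_(m, n)} {g : T -> 'M[R]_(n, p)}
    {A : 'M[R]_(m, n)} {B : 'M[R]_(n, p)} :
  f t @[t --> F] --> A -> g t @[t --> F] --> B ->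
  f t *m g t @[t --> F] --> A *m B.
Proof.
move=> fA gB; apply: cvg_mx => i j; rewrite mxE.
under eq_cvg do rewrite mxE.
by apply: cvg_sumr => k _; apply: cvgM; apply: cvg_mx_coord.
Qed.

Lemma cvg_mulmxl {R : realType} {T : Type} {F : set_system T} {FF : Filter F}
    {m n p : nat} (A : 'M[R]_(m, n)) {g : T -> 'M[R]_(n, p)}
    {B : 'M[R]_(n, p)} :
  g t @[t --> F] --> B -> A *m g t @[t --> F] --> A *m B.
Proof. by move=> gB; apply: cvg_mulmx => //; exact: cvg_cst. Qed.

Lemma cvg_det {R : realType} {T : Type} {F : set_system T} {FF : Filter F}
    {n : nat} {f : T -> 'M[R]_n} {A : 'M[R]_n} :
  f t @[t --> F] --> A -> \det (f t) @[t --> F] --> \det A.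
Proof.
move=> fA; apply: cvg_sumr => p _; apply: cvgM; first exact: cvg_cst.
by apply: cvg_prodr => i _; exact: cvg_mx_coord.
Qed.

Lemma cvg_adj {R : realType} {T : Type} {F : set_system T} {FF : Filter F}
    {n : nat} {f : T -> 'M[R]_n} {A : 'M[R]_n} :
  f t @[t --> F] --> A -> \adj (f t) @[t --> F] --> \adj A.
Proof.
move=> fA; apply: cvg_mx => i j; rewrite mxE.
under eq_cvg do rewrite mxE.
apply: cvgM; first exact: cvg_cst.
apply: cvg_det; apply: cvg_mx => k l; rewrite !mxE.
by under eq_cvg do rewrite !mxE; exact: cvg_mx_coord.
Qed.

(** Cramer's rule: the determinant is eventually nonzero, and the inverse is the adjugate divided by
    it, both continuous in the entries. *)
Lemma cvg_linear_system {R : realType} {T : Type} {F : set_system T}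
    {FF : Filter F} {n p : nat} {X : T -> 'M[R]_n} {x b : T -> 'M[R]_(n, p)}
    {X0 : 'M[R]_n} {x0 : 'M[R]_(n, p)} :
  X0 \in unitmx -> X t @[t --> F] --> X0 -> b t @[t --> F] --> X0 *m x0 ->
  (\forall t \near F, X t *m x t = b t) -> x t @[t --> F] --> x0.
Proof.
move=> X0u XX0 bb0 Xxb; have detX0 : \det X0 != 0 by rewrite -unitfE -unitmxE.
have -> : x0 = (\det X0)^-1 *: (\adj X0 *m (X0 *m x0)).
  by rewrite mulmxA mul_adj_mx mul_scalar_mx scalerA mulVf ?scale1r.
apply: cvg_trans (_ : (\det (X t))^-1 *: (\adj (X t) *m b t) @[t --> F] --> _).
  apply: near_eq_cvg; near=> t.
  have detX : \det (X t) != 0 by near: t; exact: cvgr_neq0 (cvg_det XX0) detX0.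
  rewrite -(near Xxb t)// mulmxA mul_adj_mx mul_scalar_mx scalerA mulVf//.
  by rewrite scale1r.
apply: cvgZ; first by apply: cvgV => //; exact: cvg_det.
by apply: cvg_mulmx => //; exact: cvg_adj.
Unshelve. all: by end_near. Qed.

(** * Invertibility of the limiting stage matrix *)

Lemma unitmx_inj {K : fieldType} {n : nat} (A : 'M[K]_n) :
  (forall x : 'cV[K]_n, A *m x = 0 -> x = 0) -> A \in unitmx.
Proof.
move=> A_inj; rewrite -unitmx_tr -row_free_unit; apply: inj_row_free => v vA0.
apply: trmx_inj; rewrite trmx0; apply: A_inj.
by rewrite -[A]trmxK -trmx_mul vA0 trmx0.
Qed.

(** The form is a 1-by-1 matrix, so it equals its own transpose, which is its negative. *)
Lemma qform_skew {R : realType} {N : nat} (S : 'M[R]_N) (y : 'cV[R]_N) :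
  S^T = - S -> qform S y = 0.
Proof.
move=> skewS; rewrite /qform; set a := y^T *m S *m y.
have aN : a^T = - a by rewrite !trmx_mul trmxK skewS mulmxA mulmxN mulNmx.
move: (congr1 (fun B : 'M[R]_1 => B 0 0) aN); move: a {aN} => a.
by rewrite !mxE; lra.
Qed.

Lemma SBP_unitmx {R : realType} {N : nat} {M Dp Dm D : 'M[R]_N} (a : R) :
  sym_posdef M -> M *m Dp + Dm^T *m M = 0 -> M *m D + D^T *m M = 0 ->
  1%:M + a *: (D *m Dm *m Dp) \in unitmx.
Proof.
move=> [Msym Mpos] MDp MD; apply: unitmx_inj => w.
rewrite mulmxDl mul1mx -scalemxAl => /eqP; rewrite addr_eq0 => /eqP wE.
have [x xw] : exists x, x = Dp *m w by exists (Dp *m w).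
have xE : x = - (a *: (Dp *m D *m Dm *m x)).
  by rewrite [in LHS]xw wE mulmxN -scalemxAr xw !mulmxA.
have Mx0 : qform M x = 0.
  have MDpE : M *m Dp = - (Dm^T *m M) by apply/eqP; rewrite -addr_eq0 MDp.
  have skew : (M *m D)^T = - (M *m D).
    by rewrite trmx_mul Msym; apply/eqP; rewrite -addr_eq0 addrC MD.
  (* Summation by parts moves [Dp] onto the left factor as [- Dm], which leaves the skew matrix
     [M D] between two copies of [Dm x]. *)
  have : x^T *m M *m x = a *: ((Dm *m x)^T *m (M *m D) *m (Dm *m x)).
    rewrite {2}xE mulmxN -scalemxAr -scalerN !mulmxA -(mulmxA _ M Dp) MDpE.
    by rewrite mulmxN !mulNmx opprK trmx_mul !mulmxA.
  rewrite /qform => ->; rewrite mxE.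
  by have := qform_skew _ (Dm *m x) skew; rewrite /qform => ->; rewrite mulr0.
have x0 : x = 0.
  by apply/eqP; apply: contraT => /Mpos; rewrite Mx0 ltxx.
by rewrite wE -(mulmxA _ Dp) -xw x0 mulmx0 scaler0 oppr0.
Qed.

(** * Limit of a single implicit stage *)

Lemma cvg_at_right_eq {R : realType} {V : topologicalType} {x : R}
    {f g : R -> V} {l : V} :
  (forall t, x < t -> f t = g t) -> g t @[t --> x^'+] --> l ->
  f t @[t --> x^'+] --> l.
Proof.
move=> fg; apply: cvg_trans; apply: near_eq_cvg; near=> t; apply/esym/fg.
by near: t; exact: nbhs_right_gt.
Unshelve. all: by end_near. Qed.

(** [r], [V], [W] collect the data known before the stage is solved. Their limits [V0], [W0] are
    arbitrary, since they enter only with the factor [t / a]. *)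
Lemma cvg_implicit_stage {R : realType} {N : nat} {Dp Dm D : 'M[R]_N} {a : R}
    {u v w r V W : R -> 'cV[R]_N} {u0 r0 V0 W0 : 'cV[R]_N} :
  a != 0 -> 1%:M + a *: (D *m Dm *m Dp) \in unitmx ->
  (forall t : R, 0 < t -> [/\ u t = r t - a *: (Dp *m w t),
     v t = V t + a *: (t^-1 *: (D *m v t - w t)) &
     w t = W t + a *: (t^-1 *: (- (Dm *m u t) + v t))]) ->
  r t @[t --> 0^'+] --> r0 -> V t @[t --> 0^'+] --> V0 ->
  W t @[t --> 0^'+] --> W0 -> u0 + a *: (Dp *m D *m Dm *m u0) = r0 ->
  [/\ u t @[t --> 0^'+] --> u0, v t @[t --> 0^'+] --> Dm *m u0 &
      w t @[t --> 0^'+] --> D *m Dm *m u0].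
Proof.
move=> a0 X0u stageE rr0 VV0 WW0 u0E.
have t0 : t @[t --> (0 : R)^'+] --> (0 : R).
  by apply: cvg_at_right_filter; exact: cvg_id.
have e0 : t / a @[t --> (0 : R)^'+] --> (0 : R).
  by have := cvgMr_tmp (b := a^-1) t0; rewrite mul0r; exact.
have ee0 : (t / a)%:M @[t --> (0 : R)^'+] --> (0%:M : 'M[R]_N).
  apply: cvg_mx => i j; rewrite mxE; under eq_cvg do rewrite mxE.
  exact: cvgMn.
have vE t : 0 < t -> v t = Dm *m u t + (t / a) *: (w t - W t).
  move=> t_gt0; have [_ _ wE] := stageE t t_gt0.
  have -> : w t - W t = a *: (t^-1 *: (- (Dm *m u t) + v t)).
    by rewrite wE addrC addKr.
  by rewrite !scalerA divfK// divff ?gt_eqF// scale1r addNKr.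
have wE t : 0 < t -> w t = D *m v t - (t / a) *: (v t - V t).
  move=> t_gt0; have [_ vE' _] := stageE t t_gt0.
  have -> : v t - V t = a *: (t^-1 *: (D *m v t - w t)).
    by rewrite {1}vE' addrC addKr.
  by rewrite !scalerA divfK// divff ?gt_eqF// scale1r subKr.
have ww0 : w t @[t --> 0^'+] --> D *m Dm *m u0.
  (* With [eps = t / a], [vE] and [wE] read [w = (D - eps) v + eps V] and
     [v = D_- r - eps W - (a D_- D_+ - eps) w]; eliminating [v] gives this system. *)
  apply: (@cvg_linear_system _ _ _ _ _ _
    (fun t => 1%:M + (D - (t / a)%:M) *m (a *: (Dm *m Dp) - (t / a)%:M)) _
    (fun t => (D - (t / a)%:M) *m (Dm *m r t - (t / a) *: W t)
              + (t / a) *: V t)) X0u _ _ _.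
  - have -> : 1%:M + a *: (D *m Dm *m Dp) =
        1%:M + (D - 0%:M) *m (a *: (Dm *m Dp) - 0%:M).
      by rewrite !(raddf0 (@scalar_mx R N)) !subr0 -scalemxAr mulmxA.
    apply: cvgD; first exact: cvg_cst.
    by apply: cvg_mulmx; apply: cvgB; first [exact: cvg_cst|exact: ee0].
  (* The candidate [D D_- u0] solves the limit system because [(1 + a D D_- D_+) D D_- = D D_- (1 +
     a D_+ D D_-)] and the last factor sends [u0] to [r0]. *)
  - have -> : (1%:M + a *: (D *m Dm *m Dp)) *m (D *m Dm *m u0) =
        (D - 0%:M) *m (Dm *m r0 - 0 *: W0) + 0 *: V0.
      rewrite (raddf0 (@scalar_mx R N)) !scale0r !subr0 addr0 mulmxDl mul1mx.
      by rewrite -u0E !mulmxDr -!scalemxAr -scalemxAl !mulmxA.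
    apply: cvgD; last exact: cvgZ.
    apply: cvg_mulmx; first by apply: cvgB => //; exact: cvg_cst.
    by apply: cvgB; [exact: cvg_mulmxl|exact: cvgZ].
  - near=> t; have t_gt0 : 0 < t by near: t; exact: nbhs_right_gt.
    have [uE _ _] := stageE t t_gt0.
    have wD : w t = (D - (t / a)%:M) *m v t + (t / a) *: V t.
      by rewrite mulmxBl mul_scalar_mx -addrA [- _ + _]addrC -scalerBr -opprB
                 scalerN -wE.
    have vD : v t = (Dm *m r t - (t / a) *: W t)
                    - (a *: (Dm *m Dp) - (t / a)%:M) *m w t.
      rewrite {1}vE// uE mulmxBr mulmxBl mul_scalar_mx scalerBr.
      rewrite -scalemxAl -scalemxAr !mulmxA opprB addrACA.
      by rewrite [in RHS]addrACA [- _ + _]addrC.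
    by rewrite mulmxDl mul1mx {1}wD {1}vD mulmxBr mulmxA addrAC addrNK.
have uu0 : u t @[t --> 0^'+] --> u0.
  have -> : u0 = r0 - a *: (Dp *m (D *m Dm *m u0)).
    by rewrite -u0E !mulmxA addrK.
  apply: (cvg_at_right_eq (g := fun t => r t - a *: (Dp *m w t))).
    by move=> t /stageE[].
  by apply: cvgB; [exact: rr0|apply: cvgZl_tmp; exact: cvg_mulmxl].
split; [exact: uu0| |exact: ww0].
have -> : Dm *m u0 = Dm *m u0 + 0 *: (D *m Dm *m u0 - W0).
  by rewrite scale0r addr0.
apply: (cvg_at_right_eq vE).
apply: cvgD; first exact: cvg_mulmxl.
by apply: cvgZ; [exact: e0|exact: cvgB].
Unshelve. all: by end_near. Qed.

(** * Runge-Kutta sums by component, stiff increments and stiff accuracy *)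

HB.instance Definition _ (R : realType) (N : nat) :=
  GRing.isLinear.Build R (state R N) 'cV[R]_N *:%R (@ucomp R N)
    (fun _ _ _ => erefl).
HB.instance Definition _ (R : realType) (N : nat) :=
  GRing.isLinear.Build R (state R N) 'cV[R]_N *:%R (@vcomp R N)
    (fun _ _ _ => erefl).
HB.instance Definition _ (R : realType) (N : nat) :=
  GRing.isLinear.Build R (state R N) 'cV[R]_N *:%R (@wcomp R N)
    (fun _ _ _ => erefl).

(** The two index predicates let one formula project both the stages ([j < i] and [j <= i]) and the
    update (all [j]) onto a component. *)
Lemma linear_incr {R : pzRingType} {V W : lmodType R} {I : Type} (r : seq I)
    (h : {linear V -> W}) (q : V) (dt : R) (P P' : pred I) (c c' : I -> R)
    (F F' : I -> V) :
  h (q + dt *: (\sum_(j <- r | P j) c j *: F j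
                + \sum_(j <- r | P' j) c' j *: F' j)) =
  h q + dt *: (\sum_(j <- r | P j) c j *: h (F j)
               + \sum_(j <- r | P' j) c' j *: h (F' j)).
Proof.
rewrite linearD linearZ linearD !linear_sum /=.
by congr (_ + _ *: (_ + _)); apply: eq_bigr => j _; rewrite linearZ.
Qed.

Lemma sum_lincomb0 {R : pzRingType} {V : lmodType R} {I : Type} (r : seq I)
    (P : pred I) (c : I -> R) : \sum_(j <- r | P j) c j *: (0 : V) = 0.
Proof. by rewrite big1// => j _; rewrite scaler0. Qed.

(** Isolates the implicit term of stage [i]; the other summands of the sum over [j] involve earlier
    stages only. *)
Lemma sum_ord_le_incr {R : pzRingType} {V : lmodType R} {n : nat} (i : 'I_n)
    (q S : V) (dt : R) (c : 'I_n -> R) (F : 'I_n -> V) :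
  q + dt *: (S + \sum_(j < n | (j <= i)%N) c j *: F j) =
  q + dt *: (S + \sum_(j < n | (j < i)%N) c j *: F j) + (dt * c i) *: F i.
Proof.
rewrite (bigD1 i)//= addrCA scalerDr scalerA addrCA addrC.
by under eq_bigl do rewrite andbC -ltn_neqAle.
Qed.

(** Intended for increments [k] carrying a factor [1 / tau]: their boundedness is not visible from
    their definition, but [k = (f - g) / a]. *)
Lemma cvg_increment {R : realType} {V : normedModType R} {a x : R}
    {f g k : R -> V} :
  a != 0 -> (forall t, x < t -> f t = g t + a *: k t) ->
  cvg (f t @[t --> x^'+]) -> cvg (g t @[t --> x^'+]) ->
  cvg (k t @[t --> x^'+]).
Proof.
move=> a0 fE cf cg; apply/cvg_ex.
exists (a^-1 *: (lim (f t @[t --> x^'+]) - lim (g t @[t --> x^'+]))).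
apply: (cvg_at_right_eq (g := fun t => a^-1 *: (f t - g t))) => [t xt|].
  by rewrite fE// [_ + a *: _]addrC addrK scalerA mulVf// scale1r.
by apply: cvgZl_tmp; exact: cvgB.
Qed.

Lemma cvg_kdv_f {R : realType} {T : Type} {F : set_system T} {FF : Filter F}
    {N : nat} (D : 'M[R]_N) {u : T -> 'cV[R]_N} {u0 : 'cV[R]_N} :
  u t @[t --> F] --> u0 -> kdv_f D (u t) @[t --> F] --> kdv_f D u0.
Proof.
move=> uu0; apply: cvgN; apply: cvgZl_tmp; apply: cvgD.
  apply: cvg_mulmxl; apply: cvg_mx => i j; rewrite mxE.
  under eq_cvg do rewrite mxE.
  have uij : u t i j @[t --> F] --> u0 i j by exact: cvg_mx_coord.
  exact: (cvgM uij uij).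
apply: cvg_mx => i j; rewrite mxE; under eq_cvg do rewrite mxE.
by apply: cvgM; apply: cvg_mx_coord => //; exact: cvg_mulmxl.
Qed.

Lemma gsa_update {R : realType} {s : nat} {rk : ImExRK R s} {dt : R}
    {V : lmodType R} {f g : V -> V} {q q' : V} {Q : 'I_s.+1 -> V} :
  globally_stiffly_accurate rk ->
  Q ord_max = q + dt *:
    (\sum_(j < s.+1 | (j < @ord_max s)%N) rk_At rk ord_max j *: f (Q j)
     + \sum_(j < s.+1 | (j <= @ord_max s)%N) rk_A rk ord_max j *: g (Q j)) ->
  q' = q + dt *: (\sum_(j < s.+1) rk_bt rk j *: f (Q j)
                  + \sum_(j < s.+1) rk_b rk j *: g (Q j)) ->
  q' = Q ord_max.
Proof.
move=> gsa -> ->; congr (_ + _ *: (_ + _)).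
- rewrite [RHS]big_mkcond /=; apply: eq_bigr => j _.
  case: ltnP => [_|jmax]; first by have [-> _] := gsa j.
  (* The stage sum omits [j = s]; stiff accuracy and strict triangularity make that weight of the
     update zero. *)
  by have [<- _] := gsa j; rewrite rk_explicit// scale0r.
- apply: eq_big => j; first by rewrite -ltnS ltn_ord.
  by have [_ ->] := gsa j.
Qed.

(** The determinant of a triangular matrix is the product of its diagonal. *)
Lemma type_I_diag_neq0 {R : realType} {s : nat} {rk : ImExRK R s} :
  type_I rk -> forall i, rk_A rk i i != 0.
Proof.
rewrite /type_I unitmxE unitfE det_trig ?rk_implicit// => /prodf_neq0 Aii i.
exact: Aii.
Qed.

(** * One time step, then induction over the steps *)

(** For [v] and [w] only the existence of limits is propagated: the data may be ill-prepared, and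
    their limits are identified only under stiff accuracy. *)
Lemma cvg_hyp_step {R : realType} {N s : nat} {Dp Dm D : 'M[R]_N}
    {rk : ImExRK R s} {dt : R} {q q' : R -> state R N} {e e' : 'cV[R]_N} :
  (forall a, 1%:M + a *: (D *m Dm *m Dp) \in unitmx) ->
  type_I rk -> dt != 0 ->
  (forall t : R, 0 < t ->
    imex_step rk dt (@hyp_f R N D) (@hyp_g R N Dp Dm D t) (q t) (q' t)) ->
  imex_step rk dt (@kdv_f R N D) (@kdv_g R N Dp Dm D) e e' ->
  ucomp (q t) @[t --> 0^'+] --> e ->
  cvg (vcomp (q t) @[t --> 0^'+]) -> cvg (wcomp (q t) @[t --> 0^'+]) ->
  [/\ ucomp (q' t) @[t --> 0^'+] --> e',
      cvg (vcomp (q' t) @[t --> 0^'+]), cvg (wcomp (q' t) @[t --> 0^'+]) &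
      globally_stiffly_accurate rk ->
      vcomp (q' t) @[t --> 0^'+] --> Dm *m e' /\
      wcomp (q' t) @[t --> 0^'+] --> D *m Dm *m e'].
Proof.
move=> unitX rkI dt0 hyp [E [EE e'E]] qe cv cw.
(* Choice turns the stages, given separately for each [t], into functions of [t]; for [t <= 0] they
   are set to 0, which a right limit ignores. *)
have /choice[Q hQ] : forall t : R, exists Qt : 'I_s.+1 -> state R N, 0 < t ->
    (forall i, Qt i = q t + dt *:
      (\sum_(j < s.+1 | (j < i)%N) rk_At rk i j *: hyp_f D (Qt j)
       + \sum_(j < s.+1 | (j <= i)%N) rk_A rk i j *: hyp_g Dp Dm D t (Qt j)))
    /\ q' t = q t + dt *:
      (\sum_(j < s.+1) rk_bt rk j *: hyp_f D (Qt j)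
       + \sum_(j < s.+1) rk_b rk j *: hyp_g Dp Dm D t (Qt j)).
  move=> t; have [t_gt0|t_le0] := ltP 0 t; last by exists (fun=> 0).
  by have [Qt] := hyp t t_gt0; exists Qt.
pose kv (t : R) (j : 'I_s.+1) : 'cV[R]_N :=
  t^-1 *: (D *m vcomp (Q t j) - wcomp (Q t j)).
pose kw (t : R) (j : 'I_s.+1) : 'cV[R]_N :=
  t^-1 *: (- (Dm *m ucomp (Q t j)) + vcomp (Q t j)).
(* Strong induction on [i]. Convergence of the increments belongs to the claim because later stages
   contain them through [V] and [W]. *)
have stage (i : 'I_s.+1) : [/\ ucomp (Q t i) @[t --> 0^'+] --> E i,
    vcomp (Q t i) @[t --> 0^'+] --> Dm *m E i,
    wcomp (Q t i) @[t --> 0^'+] --> D *m Dm *m E i,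
    cvg (kv t i @[t --> 0^'+]) & cvg (kw t i @[t --> 0^'+])].
  have [k] := ubnP i; elim: k i => [i|k IH i /ltnSE le_ik].
    by rewrite ltn0 => -[].
  have {}IH (j : 'I_s.+1) (ltji : (j < i)%N) := IH j (leq_trans ltji le_ik).
  pose a := dt * rk_A rk i i.
  have a0 : a != 0 by rewrite mulf_neq0// type_I_diag_neq0.
  pose r t := ucomp (q t) +
    dt *: (\sum_(j < s.+1 | (j < i)%N) rk_At rk i j *: kdv_f D (ucomp (Q t j))
      + \sum_(j < s.+1 | (j < i)%N) rk_A rk i j *: - (Dp *m wcomp (Q t j))).
  pose V t := vcomp (q t) +
    dt *: (0 + \sum_(j < s.+1 | (j < i)%N) rk_A rk i j *: kv t j).
  pose W t := wcomp (q t) +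
    dt *: (0 + \sum_(j < s.+1 | (j < i)%N) rk_A rk i j *: kw t j).
  have stageE t : 0 < t ->
      [/\ ucomp (Q t i) = r t - a *: (Dp *m wcomp (Q t i)),
        vcomp (Q t i) = V t + a *: kv t i & wcomp (Q t i) = W t + a *: kw t i].
    move=> /hQ[Qi _]; split; rewrite {1}Qi linear_incr /=.
    - by rewrite sum_ord_le_incr -scalerN.
    - by rewrite sum_lincomb0 sum_ord_le_incr.
    - by rewrite sum_lincomb0 sum_ord_le_incr.
  have rr0 : r t @[t --> 0^'+] --> e +
      dt *: (\sum_(j < s.+1 | (j < i)%N) rk_At rk i j *: kdv_f D (E j)
        + \sum_(j < s.+1 | (j < i)%N)
            rk_A rk i j *: - (Dp *m (D *m Dm *m E j))).
    apply: cvgD => //; apply: cvgZl_tmp; apply: cvgD.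
      by apply: cvg_lincomb => j /IH[uE _ _ _ _]; exact: cvg_kdv_f.
    apply: cvg_lincomb => j /IH[_ _ wE _ _].
    by apply: cvgN; exact: cvg_mulmxl.
  have VV0 : V t @[t --> 0^'+] --> lim (vcomp (q t) @[t --> 0^'+]) +
      dt *: (0 + \sum_(j < s.+1 | (j < i)%N)
        rk_A rk i j *: lim (kv t j @[t --> 0^'+])).
    apply: cvgD; first exact: cv.
    apply: cvgZl_tmp; apply: cvgD; first exact: cvg_cst.
    by apply: cvg_lincomb => j /IH[_ _ _ ck _]; exact: ck.
  have WW0 : W t @[t --> 0^'+] --> lim (wcomp (q t) @[t --> 0^'+]) +
      dt *: (0 + \sum_(j < s.+1 | (j < i)%N)
        rk_A rk i j *: lim (kw t j @[t --> 0^'+])).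
    apply: cvgD; first exact: cw.
    apply: cvgZl_tmp; apply: cvgD; first exact: cvg_cst.
    by apply: cvg_lincomb => j /IH[_ _ _ _ ck]; exact: ck.
  have [|uE vE wE] := cvg_implicit_stage a0 (unitX a) stageE rr0 VV0 WW0
    (u0 := E i).
    (* The remaining condition is the KdV stage equation with its diagonal term moved to the
       left. *)
    rewrite {1}EE sum_ord_le_incr /kdv_g scalerN addrNK.
    by congr (_ + _ *: (_ + _)); apply: eq_bigr => j _; rewrite !mulmxA.
  split; [exact: uE|exact: vE|exact: wE| |].
  - apply: (cvg_increment a0 (f := fun t => vcomp (Q t i)) (g := V)).
    + by move=> t /stageE[].
    + exact: cvgP vE.
    + exact: cvgP VV0.
  - apply: (cvg_increment a0 (f := fun t => wcomp (Q t i)) (g := W)).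
    + by move=> t /stageE[].
    + exact: cvgP wE.
    + exact: cvgP WW0.
(* The [u]-update has no factor [1 / tau], so it passes to the limit directly: [- D_+ w] tends to
   [kdv_g] at each stage. *)
have q'E : ucomp (q' t) @[t --> 0^'+] --> e'.
  rewrite e'E; apply: (cvg_at_right_eq (g := fun t => ucomp (q t) +
    dt *: (\sum_(j < s.+1) rk_bt rk j *: kdv_f D (ucomp (Q t j))
      + \sum_(j < s.+1) rk_b rk j *: - (Dp *m wcomp (Q t j))))).
    by move=> t /hQ[_ ->]; rewrite linear_incr.
  apply: cvgD; first exact: qe.
  apply: cvgZl_tmp; apply: cvgD; apply: cvg_lincomb => j _;
    have [uE _ wE _ _] := stage j; first exact: cvg_kdv_f.
  have -> : kdv_g Dp Dm D (E j) = - (Dp *m (D *m Dm *m E j)).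
    by rewrite /kdv_g !mulmxA.
  by apply: cvgN; exact: cvg_mulmxl.
split; [exact: q'E| | |move=> gsa].
- apply/cvg_ex; exists (lim (vcomp (q t) @[t --> 0^'+]) +
    dt *: (0 + \sum_(j < s.+1) rk_b rk j *: lim (kv t j @[t --> 0^'+]))).
  apply: (cvg_at_right_eq (g := fun t => vcomp (q t) +
    dt *: (0 + \sum_(j < s.+1) rk_b rk j *: kv t j))).
    by move=> t /hQ[_ ->]; rewrite linear_incr sum_lincomb0.
  apply: cvgD; first exact: cv.
  apply: cvgZl_tmp; apply: cvgD; first exact: cvg_cst.
  by apply: cvg_lincomb => j _; have [_ _ _ ck _] := stage j; exact: ck.
- apply/cvg_ex; exists (lim (wcomp (q t) @[t --> 0^'+]) +
    dt *: (0 + \sum_(j < s.+1) rk_b rk j *: lim (kw t j @[t --> 0^'+]))).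
  apply: (cvg_at_right_eq (g := fun t => wcomp (q t) +
    dt *: (0 + \sum_(j < s.+1) rk_b rk j *: kw t j))).
    by move=> t /hQ[_ ->]; rewrite linear_incr sum_lincomb0.
  apply: cvgD; first exact: cw.
  apply: cvgZl_tmp; apply: cvgD; first exact: cvg_cst.
  by apply: cvg_lincomb => j _; have [_ _ _ _ ck] := stage j; exact: ck.
- have q'Q (t : R) : 0 < t -> q' t = Q t ord_max.
    by move=> /hQ[Qi q'Qt]; exact: gsa_update gsa (Qi ord_max) q'Qt.
  rewrite (gsa_update gsa (EE ord_max) e'E).
  have [_ vE wE _ _] := stage ord_max.
  split; [move: vE|move: wE]; apply: cvg_at_right_eq => t t_gt0;
    by rewrite q'Q.
Qed.

Theorem theorem5 (R : realType) (N s : nat)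
    (U : periodic_upwind_SBP R N) (C : periodic_SBP R N)
    (diagonal_norm : is_diag_mx (upw_M U))
    (same_mass : sbp_M C = upw_M U)
    (rk : ImExRK R s) (rk_type_I : type_I rk)
    (dt : R) (dt_gt0 : 0 < dt) :
  AP_u (upw_Dp U) (upw_Dm U) (sbp_D C) rk dt /\
  (globally_stiffly_accurate rk ->
   AP_aux (upw_Dp U) (upw_Dm U) (sbp_D C) rk dt).
Proof.
(* The shared mass matrix allows both summation-by-parts identities in one inner product. *)
have unitX a : 1%:M + a *: (sbp_D C *m upw_Dm U *m upw_Dp U) \in unitmx.
  apply: SBP_unitmx (upw_mass U) (upw_parts U) _.
  by rewrite -same_mass sbp_parts.
have dt0 : dt != 0 by rewrite gt_eqF.
have conv (q : R -> nat -> state R N) (eta : nat -> 'cV[R]_N) (n : nat) :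
    relaxation_limit_data (upw_Dp U) (upw_Dm U) (sbp_D C) rk dt q eta ->
    [/\ ucomp (q t n) @[t --> 0^'+] --> eta n,
        cvg (vcomp (q t n) @[t --> 0^'+]) & cvg (wcomp (q t n) @[t --> 0^'+])].
  case=> hyp kdv u0 [v0 cv0] [w0 cw0]; elim: n => [|n [un vn wn]].
    by split=> //; apply/cvg_ex; [exists v0|exists w0].
  by have [] := cvg_hyp_step unitX rk_type_I dt0
    (fun t t_gt0 => hyp t t_gt0 n) (kdv n) un vn wn.
split=> [q eta data n|gsa q eta data n].
  by have [] := conv q eta n.+1 data.
have [un vn wn] := conv q eta n data; case: data => hyp kdv _ _ _.
have [_ _ _] := cvg_hyp_step unitX rk_type_I dt0
  (fun t t_gt0 => hyp t t_gt0 n) (kdv n) un vn wn.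
exact.
Qed.
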